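(* For any odd prime $p$, the set $\{\theta_{\Lambda_{a,b}}(q) : a,b\in\mathbb{Z}\}$ contains at most $\frac{(p+1)^2}{4}$ elements.
   Context: Let $\ell>0$ be a square-free integer with $\ell\equiv 3 \pmod 4$, and let $d$ be the positive integer with $\ell=4d-1$. Let $K=\mathbb{Q}(\sqrt{-\ell})$, with ring of integers $\mathcal{O}_K=\mathbb{Z}[\omega_\ell]$, where $\omega_\ell=\frac{-1+\sqrt{-\ell}}{2}$. For a prime $p$ and integers $a,b$, let $\Lambda_{a,b}$ denote the coset $a-b\omega_\ell+p\mathcal{O}_K$, with theta series $$\theta_{\Lambda_{a,b}}(q)=\sum_{m,n\in\mathbb{Z}}q^{|a+mp-(b+np)\omega_\ell|^2}=\sum_{m,n\in\mathbb{Z}}q^{Q_d(mp+a,\,np+b)},\qquad Q_d(x,y)=|x-y\omega_\ell|^2=x^2+xy+dy^2.$$ *)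

(* Defs.v *)
From mathcomp Require Import all_boot all_order all_algebra all_field.
From mathcomp Require Import finmap all_classical.
From mathcomp Require Import zify ring lra.

Set Implicit Arguments.
Unset Strict Implicit.
Unset Printing Implicit Defensive.
Import Order.TTheory GRing.Theory Num.Theory.
Local Open Scope classical_set_scope.
Local Open Scope ring_scope.

Definition squarefree (n : nat) : Prop :=
  forall r : nat, (r ^ 2 %| n)%N -> r = 1%N.

(* The square root of -l in the upper half plane. *)
Definition sqrtN (l : nat) : algC := 'i * sqrtC l%:R.

Definition omega (l : nat) : algC := (-1 + sqrtN l) / 2.

(* The imaginary quadratic field Q(sqrt(-l)), as a subfield of algC. *)
Definition K (l : nat) : set algC :=
  [set z | exists r s : rat, z = ratr r + ratr s * sqrtN l].

(* The ring of integers of K l; [Aint] is the ring of all algebraic integers. *)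
Definition OK (l : nat) : set algC := K l `&` [set z | z \in Aint].

Definition Lambda (l p : nat) (a b : int) : set algC :=
  [set a%:~R - b%:~R * omega l + p%:R * x | x in OK l].

(* The theta series, i.e. the sum of q^(|z|^2) over all z in L, as a formal   *)
(* power series in q given by its sequence of coefficients: the coefficient   *)
(* of q^k is the number of z in L with |z|^2 = k. As [fset_set] is empty on   *)
(* infinite sets, this is meaningful only when all |z|^2 are natural numbers  *)
(* and each value is taken finitely often: for the cosets [Lambda], these are *)
(* [norm_Lambda] and [finite_fibre] below.                                    *)
Definition theta (L : set algC) : nat -> nat :=
  fun k => (#|` fset_set [set z | L z /\ `|z| ^+ 2 = k%:R]|)%fset.

Definition Q (d : nat) (x y : int) : int := x ^+ 2 + x * y + d%:Z * y ^+ 2.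

Lemma sqrtN2 l : sqrtN l ^+ 2 = - l%:R.
Proof. by rewrite /sqrtN exprMn sqrCi sqrtCK mulN1r. Qed.

Lemma conj_sqrtN l : (sqrtN l)^* = - sqrtN l.
Proof.
rewrite /sqrtN rmorphM /= conjCi mulNr (CrealP _) //.
by rewrite ger0_real // sqrtC_ge0 ler0n.
Qed.

Lemma conj_omega l : (omega l)^* = (-1 - sqrtN l) / 2.
Proof.
by rewrite /omega fmorph_div (rmorphD _ _ (sqrtN l)) rmorphN1 /= conj_sqrtN conjC_nat.
Qed.

Section Integers.
Variables l d : nat.
Hypotheses (l_gt0 : (0 < l)%N) (lE : l = (4 * d - 1)%N).

Let lEC : l%:R = 4 * d%:R - 1 :> algC.
Proof.
have -> : (4 * d%:R : algC) = (l + 1)%:R by rewrite -natrM; congr _%:R; lia.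
by rewrite natrD addrK.
Qed.

Lemma omega_quad : omega l ^+ 2 + omega l + d%:R = 0.
Proof.
have := sqrtN2 l; rewrite lEC /omega => h.
have -> : (d%:R : algC) = (1 - sqrtN l ^+ 2) / 4 by rewrite h; field.
by field.
Qed.

Lemma sqrtN_omega : sqrtN l = 2 * omega l + 1.
Proof. by rewrite /omega; field. Qed.

Lemma norm_omega (x y : int) :
  `|x%:~R - y%:~R * omega l| ^+ 2 = (Q d x y)%:~R.
Proof.
rewrite normCK rmorphB rmorphM !rmorph_int /= conj_omega /omega /Q.
rewrite !(rmorphD, rmorphM, rmorphXn) /=.
have -> : (d%:Z%:~R : algC) = (1 - sqrtN l ^+ 2) / 4.
  by rewrite sqrtN2 lEC -pmulrn; field.
by field.
Qed.

Lemma Aint_omega : omega l \in Aint.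
Proof.
apply: (@root_monic_Aint ('X^2 + 'X + (d%:R)%:P)).
- by rewrite rootE !hornerE omega_quad.
- rewrite -addrA monicE lead_coefDl ?lead_coefXn //.
  by rewrite size_polyXn size_XaddC.
- apply/polyOverP=> i; rewrite !coefE;
  by case: i => [|[|[|i]]] /=; rewrite ?(add0r, addr0).
Qed.

Lemma OK_Zomega : (l %% 4 = 3)%N -> squarefree l ->
  OK l = [set z | exists x y : int, z = x%:~R - y%:~R * omega l].
Proof.
move=> l3 sql; apply/seteqP; split=> z /=; last first.
  case=> x [y ->]; split; last first.
    rewrite /=; apply: rpredB; first exact: Aint_int.
    by apply: rpredM; [exact: Aint_int | exact: Aint_omega].
  exists (x%:~R + y%:~R / 2), (- (y%:~R / 2)).
  rewrite rmorphN rmorphD !fmorph_div !rmorph_int /omega rmorph_nat.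
  by field.
case=> [[r [s zE]]] /= zA.
have zcE : z^* = ratr r - ratr s * sqrtN l.
  rewrite zE rmorphD (rmorphM _ (ratr s) (sqrtN l)) /= conj_sqrtN mulrN.
  by rewrite !conj_Crat ?Crat_rat.
have zcA : z^* \in Aint by rewrite (Aint_aut (Num.conj : {rmorphism algC -> algC})).
have /intrP[t tE] : ratr (2 * r) \is a @Num.int algC.
  apply: Cint_rat_Aint; first exact: Crat_rat.
  have -> : ratr (2 * r) = z + z^*.
    by rewrite zcE zE rmorphM rmorph_nat /=; ring.
  exact: rpredD.
have /intrP[n nE] : ratr (r ^+ 2 + l%:R * s ^+ 2) \is a @Num.int algC.
  apply: Cint_rat_Aint; first exact: Crat_rat.
  have -> : ratr (r ^+ 2 + l%:R * s ^+ 2) = z * z^*.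
    rewrite zcE zE rmorphD rmorphM !rmorphXn rmorph_nat /=.
    have -> : (l%:R : algC) = - (sqrtN l ^+ 2) by rewrite sqrtN2 opprK.
    by ring.
  exact: rpredM.
have {}tE : 2 * r = t%:~R by apply: (fmorph_inj (@ratr algC)); rewrite rmorph_int -tE.
have {}nE : r ^+ 2 + l%:R * s ^+ 2 = n%:~R.
  by apply: (fmorph_inj (@ratr algC)); rewrite rmorph_int -nE.
pose v := 2 * s.
have vE : l%:R * v ^+ 2 = (4 * n - t ^+ 2)%:~R.
  by rewrite rmorphB rmorphM rmorphXn /= -nE -tE /v; ring.
have [u uE] : exists u : int, v = u%:~R.
  exists (numq v).
  suff d1 : denq v = 1 by rewrite -{1}(divq_num_den v) d1 divr1.
  have cop := coprime_num_den v.
  have hI : l%:Z * numq v ^+ 2 = (4 * n - t ^+ 2) * denq v ^+ 2.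
    have vq : v = (numq v)%:~R / (denq v)%:~R by rewrite divq_num_den.
    have : (denq v)%:~R != 0 :> rat by rewrite intr_eq0 denq_neq0.
    move: (numq v) (denq v) vq {cop} => a b vq b0; apply: (@intr_inj rat).
    by rewrite [LHS]intrM [RHS]intrM -vE vq !expr2 !intrM -pmulrn; field.
  have dv : (`|denq v| ^ 2 %| l)%N.
    rewrite -(@Gauss_dvdl _ _ (`|numq v| ^ 2)%N); last first.
      by rewrite coprime_pexpl // coprime_pexpr // coprime_sym.
    have -> : (l * `|numq v| ^ 2 = `|(l%:Z * numq v ^+ 2)%R|)%N by rewrite abszM abszX.
    by rewrite hI abszM abszX dvdn_mull.
  have := sql _ dv.
  by have := denq_gt0 v; lia.
have uE2 : l%:Z * u ^+ 2 = 4 * n - t ^+ 2.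
  by apply: (@intr_inj rat); rewrite -vE uE rmorphM rmorphXn.
have [x xE] : exists x : int, t + u = 2 * x.
  exists (((t + u) %/ 2)%Z); have lZ : l%:Z = 4 * d%:Z - 1 by lia.
  have h4 : (t - u) * (t + u) = 4 * (n - d%:Z * u ^+ 2).
    by move: uE2; rewrite lZ; nia.
  nia.
exists x, (- u).
have rE : ratr r = t%:~R / 2 :> algC.
  by rewrite -[t%:~R](rmorph_int (@ratr algC)) -tE rmorphM rmorph_nat; field.
have sE : ratr s = u%:~R / 2 :> algC.
  by rewrite -[u%:~R](rmorph_int (@ratr algC)) -uE rmorphM rmorph_nat; field.
have tx : t%:~R = 2 * x%:~R - u%:~R :> algC.
  by rewrite -[2]/(2%:~R) -intrM -intrB -xE addrK.
by rewrite zE rE sE tx rmorphN sqrtN_omega; field.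
Qed.

Lemma Q_lb (x y : int) : x ^+ 2 <= 2 * Q d x y /\ y ^+ 2 <= 2 * Q d x y.
Proof.
have d1 : 0 <= d%:Z - 1 by lia.
have hd := mulr_ge0 d1 (sqr_ge0 y).
have e1 : 4 * Q d x y =
    (2 * x + y) ^+ 2 + 3 * y ^+ 2 + 4 * ((d%:Z - 1) * y ^+ 2).
  by rewrite /Q; ring.
have e2 : 4 * Q d x y =
    3 * x ^+ 2 + (x + 2 * y) ^+ 2 + 4 * ((d%:Z - 1) * y ^+ 2).
  by rewrite /Q; ring.
have := (sqr_ge0 x, sqr_ge0 y, sqr_ge0 (2 * x + y), sqr_ge0 (x + 2 * y)).
by move=> [[[? ?] ?] ?]; split; lra.
Qed.

Lemma Q_eq0 (x y : int) : Q d x y = 0 -> x = 0 /\ y = 0.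
Proof.
have [+ +] := Q_lb x y => + + Q0; rewrite Q0 mulr0 => hx hy.
by split; apply/eqP; rewrite -sqrf_eq0 eq_le sqr_ge0 ?hx ?hy.
Qed.

Lemma finite_Q (k : nat) : finite_set [set xy : int * int | Q d xy.1 xy.2 = k].
Proof.
have finZ N : finite_set [set x : int | `|x| <= N%:Z].
  apply: (@sub_finite_set _ _ ((fun i : nat => i%:Z - N%:Z) @` `I_(2 * N).+1)).
    by move=> x /= xN; exists `|(x + N%:Z)%R|%N => /=; lia.
  exact/finite_image/finite_II.
apply: sub_finite_set (finite_setX (finZ (4 * k)%N) (finZ (4 * k)%N)).
case=> x y /= Qk; have [] := Q_lb x y; rewrite Qk => hx hy.
by split=> /=; nia.
Qed.

Section Coset.
Hypotheses (l3 : (l %% 4 = 3)%N) (sql : squarefree l).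
Variables (p : nat) (a b : int).
Hypothesis (p_gt0 : (0 < p)%N).

Let pt (mn : int * int) : algC :=
  (mn.1 * p%:Z + a)%:~R - (mn.2 * p%:Z + b)%:~R * omega l.

Let LambdaE : Lambda l p a b = range pt.
Proof.
rewrite /Lambda OK_Zomega //; apply/seteqP; split=> z /=.
  case=> _ [m [n ->]] <-; exists (m, n) => //.
  by rewrite /pt /= !intrD !intrM -!pmulrn; ring.
case=> -[m n] _ <-; exists (m%:~R - n%:~R * omega l); first by exists m, n.
by rewrite /pt /= !intrD !intrM -!pmulrn; ring.
Qed.

Lemma norm_Lambda z : Lambda l p a b z -> exists k : nat, `|z| ^+ 2 = k%:R.
Proof.
rewrite LambdaE => -[mn _ <-]; rewrite /pt norm_omega.
set x := Q _ _ _; exists `|x|%N; rewrite -[RHS]/(`|x|%N%:Z%:~R) gez0_abs //.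
by rewrite -(ler_int algC) /x -norm_omega exprn_ge0.
Qed.

Let fibreE k : [set z | Lambda l p a b z /\ `|z| ^+ 2 = k%:R] =
  pt @` [set mn : int * int |
           Q d (mn.1 * p%:Z + a) (mn.2 * p%:Z + b) = k].
Proof.
rewrite LambdaE; apply/seteqP; split=> z /=.
  case=> -[mn _ <-]; rewrite /pt norm_omega => h.
  by exists mn => //=; apply: (@intr_inj algC); rewrite h.
case=> mn h <-; split; first by exists mn.
by rewrite /pt norm_omega h.
Qed.

Let pt_inj : injective pt.
Proof.
move=> [m n] [m' n']; rewrite /pt /= => h.
have := norm_omega ((m - m') * p%:Z) ((n - n') * p%:Z).
have -> : ((m - m') * p%:Z)%:~R - ((n - n') * p%:Z)%:~R * omega l = 0.
  move/eqP: h; rewrite -subr_eq0 => /eqP <-.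
  by rewrite !(intrM, intrB, intrD); ring.
rewrite normr0 expr0n /= => /esym/eqP; rewrite intr_eq0 => /eqP/Q_eq0[].
by move=> h1 h2; congr pair; nia.
Qed.

Let finite_pairs (k : nat) : finite_set [set mn : int * int |
  Q d (mn.1 * p%:Z + a) (mn.2 * p%:Z + b) = k].
Proof.
pose f (mn : int * int) : int * int := (mn.1 * p%:Z + a, mn.2 * p%:Z + b).
have f_inj : injective f by move=> [m n] [m' n'] [h1 h2]; congr pair; nia.
have := finite_preimage (fun x y _ _ => @f_inj x y) (finite_Q k).
exact.
Qed.

Lemma finite_fibre k :
  finite_set [set z | Lambda l p a b z /\ `|z| ^+ 2 = k%:R].
Proof. by rewrite fibreE; exact: finite_image. Qed.

Lemma thetaE k : theta (Lambda l p a b) k =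
  (#|` fset_set [set mn : int * int |
                  Q d (mn.1 * p%:Z + a) (mn.2 * p%:Z + b) = k] |)%fset.
Proof.
apply/fcard_eq; [exact: finite_fibre | exact: finite_pairs|].
by rewrite fibreE; apply: inj_card_eq => ? ? _ _; exact: pt_inj.
Qed.

End Coset.

End Integers.

(* Main.v *)
Require Import Defs.
From mathcomp Require Import all_boot all_order all_algebra all_field.
From mathcomp Require Import finmap all_classical.
From mathcomp Require Import zify ring.

(** Negation and complex conjugation, [(x, y) |-> (x + y, - y)], preserve [Q d].
In the coordinates [u = 2x + y] and [y], they act by [(- u, - y)] and
[(u, - y)], so the theta series depends only on [u] and [y] modulo [p] up to
independent signs, and each of these classes is represented by an integer in
[[0, (p - 1) / 2]]. *)

Import Order.TTheory GRing.Theory Num.Theory.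
Local Open Scope classical_set_scope.
Local Open Scope ring_scope.

Section ThetaSymmetries.
Variables (l d p : nat).
Hypotheses (l_gt0 : (0 < l)%N) (lE : l = (4 * d - 1)%N).
Hypotheses (l3 : (l %% 4 = 3)%N) (sql : squarefree l) (p_gt0 : (0 < p)%N).

(** Since [fset_set] is empty on infinite sets, finiteness is what lets [fcard_eq] reduce equality
    of coefficients to a bijection. *)
Lemma finite_Q_coset (a b : int) (k : nat) :
  finite_set [set mn : int * int |
    Q d (mn.1 * p%:Z + a) (mn.2 * p%:Z + b) = k].
Proof.
pose f (mn : int * int) : int * int := (mn.1 * p%:Z + a, mn.2 * p%:Z + b).
have f_inj : injective f by move=> [m n] [m' n'] [h1 h2]; congr pair; nia.
exact: (finite_preimage (in2W f_inj) (finite_Q l_gt0 lE k)).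
Qed.

(** For every [k], [f] maps the index pairs counted by the [k]-th coefficient on the left
    bijectively onto those counted on the right. *)
Lemma eq_theta_Lambda (f g : int * int -> int * int) (a b a' b' : int) :
    cancel f g -> cancel g f ->
    (forall mn, Q d ((f mn).1 * p%:Z + a') ((f mn).2 * p%:Z + b') =
                Q d (mn.1 * p%:Z + a) (mn.2 * p%:Z + b)) ->
  theta (Lambda l p a b) = theta (Lambda l p a' b').
Proof.
move=> fK gK Qf; apply/funext => k.
rewrite !(thetaE l_gt0 lE l3 sql _ _ p_gt0).
apply/fcard_eq; [exact: finite_Q_coset | exact: finite_Q_coset |].
pose A (x y : int) : set (int * int) :=
  [set mn | Q d (mn.1 * p%:Z + x) (mn.2 * p%:Z + y) = k].
have fA : f @` A a b = A a' b'.
  apply/seteqP; split=> [_ [mn Amn <-] | mn Amn]; first by rewrite /A /= Qf.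
  by exists (g mn); rewrite ?gK // /A /= -Qf gK.
rewrite -/(A a b) -/(A a' b') -fA card_eq_sym.
by apply: inj_card_eq => ? ? _ _; exact: (can_inj fK).
Qed.

Lemma theta_LambdaD (a b s t : int) :
  theta (Lambda l p (a + s * p%:Z) (b + t * p%:Z)) = theta (Lambda l p a b).
Proof.
apply: (eq_theta_Lambda (fun mn => (mn.1 + s, mn.2 + t))
                        (fun mn => (mn.1 - s, mn.2 - t))).
- by case=> m n /=; rewrite !addrK.
- by case=> m n /=; rewrite !subrK.
- by case=> m n; congr (Q d _ _) => /=; ring.
Qed.

Lemma theta_LambdaN (a b : int) :
  theta (Lambda l p (- a) (- b)) = theta (Lambda l p a b).
Proof.
pose f (mn : int * int) := (- mn.1, - mn.2).
have fK : cancel f f by case=> m n; rewrite /f /= !opprK.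
by apply: (eq_theta_Lambda f f) => // -[m n]; rewrite /Q /=; ring.
Qed.

(** The conjugate of [omega l] is [- 1 - omega l], so that of [x - y * omega l] is
    [(x + y) + y * omega l]. *)
Lemma theta_Lambda_conj (a b : int) :
  theta (Lambda l p (a + b) (- b)) = theta (Lambda l p a b).
Proof.
pose f (mn : int * int) := (mn.1 + mn.2, - mn.2).
have fK : cancel f f by case=> m n; rewrite /f /= addrK opprK.
by apply: (eq_theta_Lambda f f) => // -[m n]; rewrite /Q /=; ring.
Qed.

End ThetaSymmetries.

Lemma residue_up_to_sign (p : nat) (x : int) : odd p ->
  exists2 i : nat, (i < p.+1./2)%N &
    exists t : int, x = i%:Z + t * p%:Z \/ x = - i%:Z + t * p%:Z.
Proof.
move=> podd; have p_gt0 : (0 < p)%N by case: p podd.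
have pE : p = (p./2).*2.+1 by rewrite -[LHS]odd_double_half podd.
pose r := `|(x %% p)%Z|%N.
have xE : x = r%:Z + (x %/ p)%Z * p%:Z.
  by rewrite {1}(divz_eq x p) /r gez0_abs ?modz_ge0; lia.
have rp : (r < p)%N by have := ltz_pmod x (_ : 0 < p%:Z); rewrite /r; lia.
have [r_lt | r_ge] := ltnP r p.+1./2.
  by exists r => //; exists (x %/ p)%Z; left.
(* Here [r + q * p = - (p - r) + (q + 1) * p], and [p - r <= (p - 1) / 2]. *)
exists (p - r)%N; first by lia.
by exists ((x %/ p)%Z + 1); right; lia.
Qed.

Theorem corollary3 (l d : nat) (hl0 : (0 < l)%N) (hl : squarefree l)
  (hl3 : (l %% 4 = 3)%N) (hd0 : (0 < d)%N) (hd : l = (4 * d - 1)%N)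
  (p : nat) (hp : prime p) (hp2 : odd p) :
  ([set theta (Lambda l p a b) | a in [set: int] & b in [set: int]]
     #<= `I_((p + 1) ^ 2 %/ 4))%card.
Proof.
have p_gt0 := prime_gt0 hp.
pose h := p.+1./2.
have pE : p.+1 = (2 * h)%N by rewrite /h; lia.
have -> : ((p + 1) ^ 2 %/ 4 = h * h)%N.
  by rewrite addn1 pE expnMn mulKn // mulnn.
have pZ : p%:Z = 2 * h%:Z - 1 by lia.
(* As [2h = 1] modulo [p], [h (u - y)] is the [x] with [2x + y = u]. *)
pose T (u y : int) := theta (Lambda l p (h%:Z * (u - y)) y).
have thetaT (a b : int) : theta (Lambda l p a b) = T (2 * a + b) b.
  (* The shift is by [a * p] because [h * (2 * a) = a + a * p]. *)
  rewrite -(theta_LambdaD l d p hl0 hd hl3 hl p_gt0 a b a 0).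
  by rewrite /T; congr (theta (Lambda _ _ _ _)); rewrite ?pZ; ring.
have TD (u y s t : int) : T (u + s * p%:Z) (y + t * p%:Z) = T u y.
  rewrite /T -(theta_LambdaD l d p hl0 hd hl3 hl p_gt0 _ y (h%:Z * (s - t)) t).
  by congr (theta (Lambda _ _ _ _)); ring.
have TN (u y : int) : T (- u) (- y) = T u y.
  rewrite /T -(theta_LambdaN l d p hl0 hd hl3 hl p_gt0 _ y).
  by congr (theta (Lambda _ _ _ _)); ring.
have TNr (u y : int) : T u (- y) = T u y.
  rewrite /T -(theta_Lambda_conj l d p hl0 hd hl3 hl p_gt0 _ y).
  rewrite -(theta_LambdaD l d p hl0 hd hl3 hl p_gt0 _ (- y) (- y) 0).
  by congr (theta (Lambda _ _ _ _)); rewrite ?pZ; ring.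
have TNl (u y : int) : T (- u) y = T u y by rewrite -TNr TN.
(* The pairs [(i, j)] with [i, j < h] are coded as [i * h + j < h * h], so it suffices that [F] on
   these codes reaches every theta series. *)
pose F (n : nat) := T (n %/ h)%N%:Z (n %% h)%N%:Z.
apply: card_le_trans (card_image_le F _).
apply: subset_card_le => _ [a _ [b _ <-]].
have [i ih [s us]] := residue_up_to_sign p (2 * a + b) hp2.
have [j jh [t bt]] := residue_up_to_sign p b hp2.
exists (i * h + j)%N; first by rewrite /= -/h in ih jh *; nia.
rewrite /F divnMDl ?modnMDl; last by lia.
rewrite divn_small // modn_small // addn0 thetaT.
by case: us => ->; case: bt => ->; rewrite TD ?TNr ?TNl.
Qed.
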